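(* Assume that $\mathbb E_\mu X^2<\infty$, $\mathbb E_\mu Y_i^2<\infty$ for $i=1,\dots,d-1$, $\mathbb E_\mu L^2<\infty$, and that the covariance matrix $\Sigma_\mu(X,\boldsymbol Y)$ is invertible. Then for every $\delta>0$ $$\inf_{\mathbb P'}\left\{\mathbb E'X:\ D_\mu(\mathbb P',\mathbb P)\le\delta,\ \mathbb E'\boldsymbol Y=\mathbb E\boldsymbol Y\right\}\ \ge\ \mathbb E X-\sqrt{\delta\,\frac{\det\{\Sigma_\mu(X,\boldsymbol Y)\}}{\det\{\Sigma_\mu(\boldsymbol Y)\}}},$$ where the infimum is over all probability measures $\mathbb P'$ on $(\Omega,\mathcal F)$ satisfying the stated constraints, with equality if and only if $$X-\mathbb E_\mu X-\mathrm{cov}_\mu(X,\boldsymbol Y)\,\Sigma_\mu(\boldsymbol Y)^{-1}(\boldsymbol Y-\mathbb E_\mu\boldsymbol Y)-\sqrt{\frac{\det\{\Sigma_\mu(X,\boldsymbol Y)\}}{\delta\det\{\Sigma_\mu(\boldsymbol Y)\}}}\;L\ \le\ 0\qquad\mu\text{-a.s.}$$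
   Context: Let $d\ge 2$ and let $(X,\boldsymbol Y^\top)=(X,Y_1,\dots,Y_{d-1})$ be a real random vector on a measurable space $(\Omega,\mathcal F)$. Let $\mathbb P$ (the reference model) and $\mu$ (the dominating measure) be probability measures on $(\Omega,\mathcal F)$ with $\mathbb P\ll\mu$, and let $L=\mathrm d\mathbb P/\mathrm d\mu$ be the Radon--Nikodym derivative; it is assumed that $L$ is measurable with respect to $\sigma(X,\boldsymbol Y)$. $\mathbb E$, $\mathbb E'$ and $\mathbb E_\mu$ denote expectation under $\mathbb P$, $\mathbb P'$ and $\mu$, respectively. For a probability measure $\mathbb P'$ on $(\Omega,\mathcal F)$, $D_\mu(\mathbb P',\mathbb P)=\mathbb E_\mu(L'-L)^2$ if $\mathbb P'\ll\mu$ with $L'=\mathrm d\mathbb P'/\mathrm d\mu$, and $D_\mu(\mathbb P',\mathbb P)=\infty$ if $\mathbb P'$ is not absolutely continuous with respect to $\mu$. $\Sigma_\mu(X,\boldsymbol Y)$ is the $d\times d$ covariance matrix of $(X,\boldsymbol Y^\top)$ under $\mu$, $\Sigma_\mu(\boldsymbol Y)$ is the $(d-1)\times(d-1)$ covariance matrix of $\boldsymbol Y$ under $\mu$, and $\mathrm{cov}_\mu(X,\boldsymbol Y)$ is the row vector $(\mathrm{cov}_\mu(X,Y_1),\dots,\mathrm{cov}_\mu(X,Y_{d-1}))$ of covariances under $\mu$. *)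

(* Defs.v *)
From HB Require Import structures.
From mathcomp Require Export all_boot all_order all_algebra.
From mathcomp Require Export all_classical all_reals all_analysis.
Export Order.TTheory GRing.Theory Num.Theory.
Export numFieldNormedType.Exports.

Set Implicit Arguments.
Unset Strict Implicit.
Unset Printing Implicit Defensive.

Local Open Scope classical_set_scope.
Local Open Scope ring_scope.

(* Real-valued version of the Radon-Nikodym derivative: when P << mu, the
   library's 'd P '/d mu is finite everywhere, so [fine] loses nothing; when
   P is not absolutely continuous w.r.t. mu the value is irrelevant. *)
Definition RNderiv {disp : measure_display} {T : measurableType disp}
    {R : realType} (mu P : probability T R) (w : T) : R :=
  fine (Radon_Nikodym (charge_of_finite_measure P) mu w).

(* L is any version of dP/dmu, i.e. it is determined mu-a.s. only. *)
Definition is_RNderiv {disp : measure_display} {T : measurableType disp}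
    {R : realType} (mu P : probability T R) (L : T -> R) : Prop :=
  P `<< mu /\ ae_eq mu [set: T] L (RNderiv mu P).

Definition Dmu {disp : measure_display} {T : measurableType disp}
    {R : realType} (mu P' P : probability T R) : \bar R :=
  (if `[< P' `<< mu >]
   then 'E_mu[fun w => ((RNderiv mu P' w - RNderiv mu P w) ^+ 2)%R]
   else +oo)%E.

Section random_vectors.
Context {disp : measure_display} {T : measurableType disp} {R : realType}.

(* The random vector (X, Y_1, ..., Y_n), with X at index 0. *)
Definition joint_vec (n : nat) (X : T -> R) (Y : 'I_n -> T -> R)
    (i : 'I_n.+1) : T -> R :=
  oapp Y X (unlift ord0 i).

Definition cov_mx (mu : probability T R) (n : nat) (Z : 'I_n -> T -> R) :
    'M[R]_n :=
  \matrix_(i, j) fine (covariance mu (Z i) (Z j)).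

Definition cov_row (mu : probability T R) (n : nat) (X : T -> R)
    (Y : 'I_n -> T -> R) : 'rV[R]_n :=
  \row_j fine (covariance mu X (Y j)).

Definition centered_col (mu : probability T R) (n : nat)
    (Y : 'I_n -> T -> R) (w : T) : 'cV[R]_n :=
  \col_j (Y j w - fine 'E_mu[Y j]%E).

Definition sigma_measurable (n : nat) (Z : 'I_n -> T -> R) (L : T -> R) :
    Prop :=
  forall B : set R, measurable B -> g_sigma_preimage Z (L @^-1` B).

(* D_mu is tested first: a finite D_mu makes P' dominated by mu with a
   square-integrable density difference, so that under the second-moment
   assumptions the expectations below are finite. *)
Definition feasible (mu P : probability T R) (n : nat) (Y : 'I_n -> T -> R)
    (delta : R) : set (probability T R) :=
  [set P' | (Dmu mu P' P <= delta%:E)%E /\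
            forall i, ('E_P'[Y i] = 'E_P[Y i])%E].

End random_vectors.

(* Main.v *)
From HB Require Import structures.
Require Import Defs.
From mathcomp Require Import measurable_realfun ring lra.

(** Write l for the density of P, l' for the density of a feasible P', and r
for the residual of the linear regression of X on (1, Y) in L2(mu).  Then r
differs from X by an affine function of Y and is orthogonal to 1 and to every
Y_i, and a Schur complement computation gives
det Sigma(X, Y) = v * det Sigma(Y) with v = E_mu r^2
([det_cov_mx_joint]); invertibility of Sigma(X, Y) forces v > 0.

The constraints say that h = l' - l is orthogonal to 1 and to every Y_i, so
that E'X - EX = E_mu (h X) = E_mu (h r) ([int_mul_residual]).  Without the
requirement l' >= 0, the minimiser of this linear functional over the ball
E_mu h^2 <= delta would be h = - c r with c = sqrt (delta / v), that is, the
signed density l - c r.  Expanding the square quantifies how close l' is to it: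

  E_mu (l' - (l - c r))^2 <= 2 c (E'X - (EX - sqrt (delta v)))

([int_sqr_sub_lopt]).  Everything follows from this one estimate.
- Its left-hand side is nonnegative: this is the lower bound.
- As l' >= 0, its left-hand side is at least the integral of the square of the
  negative part of l - c r.  If the infimum equals the bound, the right-hand
  side can be made arbitrarily small, hence l - c r >= 0 almost surely
  ([lopt_ge0_of_inf]).  No minimising density has to be constructed, so no
  compactness argument is involved.
- Conversely, if l - c r >= 0 almost surely, then it is the density of a
  feasible probability that attains the bound ([inf_of_lopt_ge0]).
Since 1 / c = sqrt (v / delta), the condition l - c r >= 0 is the stated
inequality. *)

Set Implicit Arguments.
Unset Strict Implicit.
Unset Printing Implicit Defensive.

Local Open Scope classical_set_scope.
Local Open Scope ring_scope.

(** * Integration of square-integrable functions *)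

Section square_integrable.
Context {disp : measure_display} {T : measurableType disp} {R : realType}.
Variable mu : probability T R.
Implicit Types f g h : T -> R.

Local Notation L1 := (Lfun mu 1).
Local Notation L2 := (Lfun mu 2%:E).

Lemma expectationE f : fine 'E_mu[f]%E = \int[mu]_x f x.
Proof. by rewrite unlock. Qed.

Lemma L2_measurable f : f \in L2 -> measurable_fun setT f.
Proof. by rewrite inE => /andP[]; rewrite inE. Qed.

Lemma sqr_lty_L2 f : measurable_fun setT f ->
  ('E_mu[fun w => (f w ^+ 2)%R] < +oo)%E -> f \in L2.
Proof.
move=> mf; rewrite unlock => f2.
rewrite inE; apply/andP; split; rewrite inE//=.
rewrite /finite_norm unlock /Lnorm poweR_lty//=.
under eq_integral do rewrite powR_mulrn// real_normK ?num_real//.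
exact: f2.
Qed.

Lemma L2_L1 f : f \in L2 -> f \in L1.
Proof. by apply: Lfun_subset12; exact: fin_num_measure. Qed.

Lemma L2_mul f g : f \in L2 -> g \in L2 -> (fun x => f x * g x) \in L1.
Proof. exact: Lfun2_mul_Lfun1. Qed.

Lemma L2_sqr f : f \in L2 -> (fun x => f x ^+ 2) \in L1.
Proof. by move=> f2; under eq_fun do rewrite expr2; exact: L2_mul. Qed.

(** The closure properties of [Lfun mu 2%:E] are stated for explicit lambda
abstractions, the form in which integrands occur. *)
Lemma L2_cst c : (fun=> c) \in L2.
Proof. exact: (Lfun_cst mu c 2). Qed.

Lemma L2_scale c f : f \in L2 -> (fun x => c * f x) \in L2.
Proof.
move=> f2; under eq_fun do rewrite mulrC.
exact: (Lfun_scale c (ler1n _ 2) f2).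
Qed.

Lemma L2_add f g : f \in L2 -> g \in L2 -> (fun x => f x + g x) \in L2.
Proof. by move=> f2 g2; apply: (rpredD f2 g2); rewrite lee1n. Qed.

Lemma L2_sub f g : f \in L2 -> g \in L2 -> (fun x => f x - g x) \in L2.
Proof. by move=> f2 g2; apply: (rpredB f2 g2); rewrite lee1n. Qed.
 
Lemma L2_sum (I : Type) (s : seq I) (F : I -> T -> R) :
  (forall i, F i \in L2) -> (fun x => \sum_(i <- s) F i x) \in L2.
Proof.
move=> F2; elim: s => [|i s IH].
  by under eq_fun do rewrite big_nil; exact: L2_cst.
by under eq_fun do rewrite big_cons; exact: L2_add.
Qed.

Lemma intD f g : f \in L1 -> g \in L1 ->
  \int[mu]_x (f x + g x) = \int[mu]_x f x + \int[mu]_x g x.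
Proof. by move=> f1 g1; rewrite RintegralD//; exact/Lfun1_integrable. Qed.

Lemma intB f g : f \in L1 -> g \in L1 ->
  \int[mu]_x (f x - g x) = \int[mu]_x f x - \int[mu]_x g x.
Proof. by move=> f1 g1; rewrite RintegralB//; exact/Lfun1_integrable. Qed.

Lemma intZ c f : f \in L1 -> \int[mu]_x (c * f x) = c * \int[mu]_x f x.
Proof. by move=> f1; rewrite RintegralZl//; exact/Lfun1_integrable. Qed.

Lemma int_cst c : \int[mu]_x c = c.
Proof. by rewrite Rintegral_cst// [X in fine X](probability_setT mu) mulr1. Qed.

Lemma int_sum (I : Type) (s : seq I) (F : I -> T -> R) :
  (forall i, F i \in L1) ->
  \int[mu]_x (\sum_(i <- s) F i x) = \sum_(i <- s) \int[mu]_x F i x.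
Proof.
move=> F1; rewrite /Rintegral.
have -> : (\int[mu]_x (\sum_(i <- s) F i x)%:E =
  \sum_(i <- s) \int[mu]_x (F i x)%:E)%E.
  under eq_integral do rewrite -sumEFin.
  rewrite integral_sum// => i; exact/Lfun1_integrable.
rewrite sum_fine// => i _; apply: integrable_fin_num => //.
exact/Lfun1_integrable.
Qed.

Lemma int_sqr_eq0 f : f \in L2 -> \int[mu]_x f x ^+ 2 = 0 -> 
  {ae mu, forall x, f x = 0}.
Proof.
move=> f2 f0; have mf := L2_measurable f2.
have : ae_eq mu setT (fun x => (f x ^+ 2)%:E) (cst 0%E).
  apply/ae_eq_integral_abs => //.
    by apply/measurable_EFinP; exact: measurable_funX.
  under eq_integral do rewrite gee0_abs ?lee_fin ?sqr_ge0//.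
  rewrite -(@fineK _ (\int[mu]_x _)%E).
    by move: f0; rewrite /Rintegral => ->.
  by apply: integrable_fin_num => //; apply/Lfun1_integrable/L2_sqr.
apply: filterS => x /= /(_ I) /eqP; rewrite eqe sqrf_eq0 => /eqP; exact.
Qed.

Lemma expectation_fin f : f \in L1 -> 'E_mu[f]%E = (\int[mu]_x f x)%:E.
Proof. by move=> f1; rewrite -expectationE fineK// expectation_fin_num. Qed.

Lemma le_int_ae f g : f \in L1 -> g \in L1 -> (forall x, 0 <= f x) ->
  (forall x, 0 <= g x) -> {ae mu, forall x, f x <= g x} ->
  \int[mu]_x f x <= \int[mu]_x g x.
Proof.
move=> f1 g1 f0 g0 fg.
rewrite -lee_fin -!expectation_fin//; apply: expectation_le => //.
- by move: f1; rewrite inE => /andP[]; rewrite inE.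
- by move: g1; rewrite inE => /andP[]; rewrite inE.
Qed.

Lemma L2_sqr_lty f : f \in L2 -> ('E_mu[fun w => (f w ^+ 2)%R] < +oo)%E.
Proof. by move=> f2; rewrite expectation_fin ?ltry//; exact: L2_sqr. Qed.

(** The domination is only almost sure, so that square-integrability also
transfers along an almost sure equality. *)
Lemma L2_dominated f g : measurable_fun setT f -> g \in L2 ->
  {ae mu, forall x, f x ^+ 2 <= g x ^+ 2} -> f \in L2.
Proof.
move=> mf g2 fg; apply: sqr_lty_L2 => //.
apply: le_lt_trans (L2_sqr_lty g2); apply: expectation_le => //.
- exact: measurable_funX.
- by apply: measurable_funX; exact: L2_measurable g2.
- by move=> x; exact: sqr_ge0.
- by move=> x; exact: sqr_ge0.
Qed.

Lemma int_ae f g : measurable_fun setT f -> measurable_fun setT g ->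
  {ae mu, forall x, f x = g x} -> \int[mu]_x f x = \int[mu]_x g x.
Proof.
move=> mf mg fg; congr fine; apply: ae_eq_integral => //.
- exact/measurable_EFinP.
- exact/measurable_EFinP.
- by apply: filterS fg => x /= ->.
Qed.

Lemma int_sqrD f g (a : R) : f \in L2 -> g \in L2 ->
  \int[mu]_x (f x + a * g x) ^+ 2 =
  \int[mu]_x f x ^+ 2 + 2 * a * \int[mu]_x (f x * g x)
  + a ^+ 2 * \int[mu]_x g x ^+ 2.
Proof.
move=> f2 g2.
have fg1 : (fun x => 2 * a * (f x * g x)) \in L1.
  under eq_fun do rewrite mulrA; apply: L2_mul => //; exact: L2_scale.
have gg1 : (fun x => a ^+ 2 * g x ^+ 2) \in L1.
  by under eq_fun do rewrite -exprMn; exact/L2_sqr/L2_scale.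
have ff1 := L2_sqr f2.
rewrite -(intZ _ (L2_mul f2 g2)) -(intZ _ (L2_sqr g2)).
rewrite -!intD//; first by apply: eq_Rintegral => x _; ring.
by apply: (rpredD ff1 fg1); rewrite lexx.
Qed.

End square_integrable.

(** * Probability measures and their densities *)

Section densities.
Context {disp : measure_display} {T : measurableType disp} {R : realType}.
Variable mu : probability T R.
Implicit Types (f g : T -> R) (Q : probability T R).

Local Notation L1 := (Lfun mu 1).
Local Notation L2 := (Lfun mu 2%:E).

Lemma RNderivK Q : Q `<< mu -> 
  EFin \o RNderiv mu Q = Radon_Nikodym (charge_of_finite_measure Q) mu.
Proof.
by move=> Qmu; apply/funext => x; rewrite /= /RNderiv fineK// Radon_Nikodym_fin_num.
Qed.

Lemma RNderiv_L1 Q : Q `<< mu -> RNderiv mu Q \in L1.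
Proof.
move=> Qmu; apply/Lfun1_integrable; rewrite RNderivK//.
exact: Radon_Nikodym_integrable.
Qed.

Lemma RNderiv_measurable Q : Q `<< mu -> measurable_fun setT (RNderiv mu Q).
Proof. by move=> /RNderiv_L1; rewrite inE => /andP[]; rewrite inE. Qed.

(** For a dominated measure two versions of the derivative are available: a
finite one, used by [RNderiv], and an everywhere nonnegative one, for which
integrals of nonnegative functions can be transported without any
integrability assumption. *)
Lemma RNderiv_ae Q : Q `<< mu -> {ae mu, forall x,
  Radon_Nikodym_SigmaFinite.f Q mu x = (RNderiv mu Q x)%:E}.
Proof.
move=> Qmu; have := ae_eq_Radon_Nikodym_SigmaFinite Qmu (@measurableT _ T).
rewrite -RNderivK//; apply: filterS => x /= /(_ I); exact.
Qed.

Lemma RNderiv_ge0 Q : Q `<< mu -> {ae mu, forall x, 0 <= RNderiv mu Q x}.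
Proof.
move=> Qmu; have := RNderiv_ae Qmu; apply: filterS => x /= e.
by rewrite -lee_fin -e; exact: Radon_Nikodym_SigmaFinite.f_ge0.
Qed.

(** By Cauchy-Schwarz the product of [f] with the density is mu-integrable.
Transporting the integral of the absolute value with the nonnegative version of
the derivative then shows that [f] is [Q]-integrable, after which the
signed change of variables applies. *)
Lemma RNderiv_expectation Q f : Q `<< mu -> RNderiv mu Q \in L2 -> f \in L2 ->
  'E_Q[f]%E = (\int[mu]_x (RNderiv mu Q x * f x))%:E.
Proof.
move=> Qmu q2 f2; have mf := L2_measurable f2.
have mq := RNderiv_measurable Qmu.
have qf1 : mu.-integrable setT (EFin \o (fun x => RNderiv mu Q x * f x)).
  exact/Lfun1_integrable/L2_mul.
have fQ : Q.-integrable setT (EFin \o f).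
  apply/integrableP; split; first exact/measurable_EFinP.
  rewrite -(@Radon_Nikodym_SigmaFinite.change_of_variables _ _ _ Q mu Qmu)//; last first.
    by apply: measurableT_comp => //; exact/measurable_EFinP.
  case/integrableP: qf1 => _; apply: le_lt_trans.
  rewrite le_eqVlt; apply/orP; left; apply/eqP; apply: ge0_ae_eq_integral => //.
  - apply: emeasurable_funM.
      by apply: measurableT_comp => //; exact/measurable_EFinP.
    exact: measurable_int (Radon_Nikodym_SigmaFinite.f_integrable Qmu).
  - apply: measurableT_comp => //; apply/measurable_EFinP; exact: measurable_funM.
  - by move=> x _; rewrite mule_ge0//; exact: Radon_Nikodym_SigmaFinite.f_ge0.
  - have := RNderiv_ae Qmu; apply: filterS2 (RNderiv_ge0 Qmu) => x /= q0 -> _.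
    by rewrite normrM ger0_norm// -EFinM mulrC.
rewrite unlock -(Radon_Nikodym_change_of_variables Qmu)//= -RNderivK//=.
rewrite -[RHS]fineK// /Rintegral /= fineK; last exact: integrable_fin_num.
by apply: eq_integral => x _; rewrite -EFinM mulrC.
Qed.

Lemma RNderiv_int1 Q : Q `<< mu -> RNderiv mu Q \in L2 ->
  \int[mu]_x RNderiv mu Q x = 1.
Proof.
move=> Qmu q2; apply: EFin_inj.
rewrite -(expectation_cst Q 1) (RNderiv_expectation Qmu q2 (L2_cst mu 1)).
by congr EFin; apply: eq_Rintegral => x _; rewrite mulr1.
Qed.

Section density_measure.
Variable g : T -> R.
Hypotheses (mg : measurable_fun setT g) (g0 : forall x, 0 <= g x).
Hypothesis g1 : (\int[mu]_x (g x)%:E = 1)%E.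

Definition density_measure (A : set T) : \bar R := (\int[mu]_(x in A) (g x)%:E)%E.

Let density_measure0 : density_measure set0 = 0%E.
Proof. exact: integral_set0. Qed.

Let density_measure_ge0 A : (0 <= density_measure A)%E.
Proof. by apply: integral_ge0 => x _; rewrite lee_fin. Qed.

Let density_measure_sigma_additive : semi_sigma_additive density_measure.
Proof. 
apply: semi_sigma_additive_nng_induced; first exact/measurable_EFinP.
by move=> x; rewrite lee_fin.
Qed.

HB.instance Definition _ := isMeasure.Build _ _ _ density_measure
  density_measure0 density_measure_ge0 density_measure_sigma_additive.

Let density_measure_setT : density_measure setT = 1%E.
Proof. exact: g1. Qed.

HB.instance Definition _ := Measure_isProbability.Build _ _ _
  density_measure density_measure_setT.

Lemma probability_of_density : exists Q : probability T R,
  Q `<< mu /\ {ae mu, forall x, RNderiv mu Q x = g x}.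
Proof.
pose Q : probability T R := density_measure.
have Qmu : Q `<< mu.
  apply/null_content_dominatesP => A mA A0; apply: null_set_integral => //.
  by apply/measurable_EFinP; exact: measurable_funTS.
exists Q; split => //.
have : ae_eq mu setT (EFin \o RNderiv mu Q) (EFin \o g).
  apply: integral_ae_eq => //.
  - exact/Lfun1_integrable/RNderiv_L1.
  - exact/measurable_EFinP.
  - by move=> E _ mE; rewrite RNderivK// -Radon_Nikodym_integral.
by apply: filterS => x /= /(_ I) [].
Qed.

End density_measure.

End densities.

(** * Covariance matrices and the regression residual *)

Section covariance_forms.
Context {disp : measure_display} {T : measurableType disp} {R : realType}.
Variable mu : probability T R.

Local Notation L1 := (Lfun mu 1).
Local Notation L2 := (Lfun mu 2%:E).
Local Notation mean f := (fine 'E_mu[f]%E).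

Lemma covariance_int (f g : T -> R) : fine (covariance mu f g) =
  \int[mu]_x ((f x - mean f) * (g x - mean g)).
Proof. by rewrite covariance.unlock expectationE; apply: eq_Rintegral. Qed.

Lemma centered_L2 (f : T -> R) : f \in L2 -> (fun x => f x - mean f) \in L2.
Proof. by move=> f2; apply: L2_sub => //; exact: L2_cst. Qed.

Lemma int_centered (f : T -> R) : f \in L2 -> \int[mu]_x (f x - mean f) = 0.
Proof.
move=> f2; rewrite intB ?int_cst ?expectationE ?subrr//; first exact: L2_L1.
exact/L2_L1/L2_cst.
Qed.

Definition lincomb n (u : 'rV[R]_n) (Z : 'I_n -> T -> R) (w : T) : R :=
  (u *m centered_col mu Z w) 0 0.

Section one_vector.
Variables (n : nat) (Z : 'I_n -> T -> R).
Hypothesis Z2 : forall i, Z i \in L2.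
Implicit Types u v : 'rV[R]_n.

Lemma lincombE u : lincomb u Z = fun w => \sum_j u 0 j * (Z j w - mean (Z j)).
Proof.
by apply/funext => w; rewrite /lincomb mxE; apply: eq_bigr => j _; rewrite mxE.
Qed.

Lemma lincomb_L2 u : lincomb u Z \in L2.
Proof.
by rewrite lincombE; apply: L2_sum => j; apply: L2_scale; exact: centered_L2.
Qed.

Lemma int_mul_lincomb (f : T -> R) u : f \in L2 ->
  \int[mu]_x (f x * lincomb u Z x) =
  \sum_j u 0 j * \int[mu]_x (f x * (Z j x - mean (Z j))).
Proof.
move=> f2; rewrite lincombE.
under eq_Rintegral do rewrite mulr_sumr.
have fZ1 j : (fun x => f x * (Z j x - mean (Z j))) \in L1.
  by apply: L2_mul => //; exact: centered_L2.
rewrite int_sum => [|j]; last first.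
  by apply: L2_mul => //; apply: L2_scale; exact: centered_L2.
apply: eq_bigr => j _; rewrite -intZ//.
by apply: eq_Rintegral => x _; rewrite mulrCA.
Qed.

Lemma int_lincomb u : \int[mu]_x lincomb u Z x = 0.
Proof.
have := int_mul_lincomb u (L2_cst mu 1).
under eq_Rintegral do rewrite mul1r.
move=> ->; apply: big1 => j _.
by under eq_Rintegral do rewrite mul1r; rewrite int_centered// mulr0.
Qed.

Lemma lincomb_cov u k : (u *m cov_mx mu Z) 0 k =
  \int[mu]_x (lincomb u Z x * (Z k x - mean (Z k))).
Proof.
under eq_Rintegral do rewrite mulrC.
rewrite int_mul_lincomb; last exact: centered_L2.
rewrite mxE; apply: eq_bigr => j _; rewrite mxE covariance_int.
by congr (_ * _); apply: eq_Rintegral => x _; rewrite mulrC.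
Qed.

Lemma lincomb_var u : (u *m cov_mx mu Z *m u^T) 0 0 = \int[mu]_x lincomb u Z x ^+ 2.
Proof.
under eq_Rintegral do rewrite expr2.
rewrite int_mul_lincomb; last exact: lincomb_L2.
by rewrite mxE; apply: eq_bigr => j _; rewrite lincomb_cov mxE mulrC.
Qed.

(** If [u] is isotropic for the covariance form, then the centred combination
[lincomb u Z] has variance zero, hence vanishes almost surely, hence is
uncorrelated with everything. *)
Lemma cov_mx_null u : u *m cov_mx mu Z *m u^T = 0 -> u *m cov_mx mu Z = 0.
Proof.
move=> /(congr1 (fun A : 'M[R]_1 => A 0 0)); rewrite lincomb_var mxE.
move=> /(int_sqr_eq0 (lincomb_L2 u)) u0.
apply/rowP => k; rewrite lincomb_cov mxE.
have uk1 : mu.-integrable setT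
    (EFin \o (fun x => lincomb u Z x * (Z k x - mean (Z k)))).
  by apply/Lfun1_integrable/L2_mul; [exact: lincomb_L2|exact: centered_L2].
rewrite -(int_cst mu 0) /Rintegral; congr fine.
apply: ae_eq_integral => //; first exact: measurable_int uk1.
by move: u0; apply: filterS => x /= -> _; rewrite mul0r.
Qed.

End one_vector.

Section regression.
Variables (n : nat) (X : T -> R) (Y : 'I_n -> T -> R).
Hypotheses (X2 : X \in L2) (Y2 : forall i, Y i \in L2).

Local Notation Z := (joint_vec X Y).
Local Notation SXY := (cov_mx mu Z : 'M[R]_(1 + n)).
Local Notation SY := (cov_mx mu Y).
Local Notation c := (cov_row mu X Y).

Lemma joint_vec_L2 i : Z i \in L2.
Proof. by rewrite /joint_vec; case: unliftP => [j|] _ /=. Qed.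

Lemma joint_vec_lshift (i : 'I_1) : Z (lshift n i) = X.
Proof.
rewrite /joint_vec (_ : lshift n i = ord0) ?unlift_none//.
by apply/val_inj; rewrite ord1.
Qed.

Lemma joint_vec_rshift j : Z (rshift 1 j) = Y j.
Proof. by rewrite /joint_vec rshift1 liftK. Qed.

Lemma cov_mx_joint :
  SXY = block_mx (fine (covariance mu X X))%:M c c^T SY.
Proof.
rewrite -[LHS](@submxK _ 1 n 1 n); congr block_mx; apply/matrixP => i j; rewrite !mxE.
- by rewrite !joint_vec_lshift !ord1 eqxx mulr1n.
- by rewrite joint_vec_lshift joint_vec_rshift.
- by rewrite joint_vec_lshift joint_vec_rshift covarianceC.
- by rewrite !joint_vec_rshift.
Qed.

Lemma lincomb_joint (a : R) (u : 'rV[R]_n) w :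
  lincomb (row_mx a%:M u : 'rV_(1 + n)) Z w = a * (X w - mean X) + lincomb u Y w.
Proof.
rewrite !lincombE (@big_split_ord _ _ _ 1 n) big_ord1 /=.
rewrite row_mxEl mxE eqxx mulr1n joint_vec_lshift; congr (_ + _).
by apply: eq_bigr => j _; rewrite row_mxEr joint_vec_rshift.
Qed.

Hypothesis SXY_unit : SXY \in unitmx.

(** A vector [u] in the left kernel of Sigma(Y) gives an isotropic vector (0, u)
of the covariance form of (X, Y), which lies in the kernel of Sigma(X, Y) by
[cov_mx_null]. *)
Lemma cov_mx_sub_unit : SY \in unitmx.
Proof.
rewrite -row_free_unit; apply/inj_row_free => u uS.
pose u' : 'rV_(1 + n) := row_mx 0 u.
have : u' *m SXY *m u'^T = 0.
  rewrite cov_mx_joint mul_row_block tr_row_mx mul_row_col !mul0mx !add0r uS.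
  by rewrite trmx0 mulmx0 mul0mx addr0.
move=> /(cov_mx_null joint_vec_L2) /(congr1 (mulmx^~ (invmx SXY))).
rewrite mulmxK// mul0mx => /eqP; rewrite row_mx_eq0 => /andP[_ /eqP]; exact.
Qed.

Definition reg_coef : 'rV[R]_n := c *m invmx SY.
Definition residual (w : T) : R := X w - mean X - lincomb reg_coef Y w.

(* The residual as a centred combination of (X, Y), so that its covariances
   with X and Y are the entries of b' *m Sigma(X, Y). *)
Let b' : 'rV[R]_(1 + n) := row_mx 1%:M (- reg_coef).

Let residualE : residual = lincomb b' Z.
Proof.
apply/funext => w; rewrite lincomb_joint mul1r /residual; congr (_ + _).
by rewrite /lincomb mulNmx [RHS]mxE.
Qed.

Lemma residual_L2 : residual \in L2.
Proof. by rewrite residualE; apply: lincomb_L2; exact: joint_vec_L2. Qed.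

Lemma int_residual : \int[mu]_x residual x = 0.
Proof. by rewrite residualE; apply: int_lincomb; exact: joint_vec_L2. Qed.

(* The Schur complement of Sigma(Y) in Sigma(X, Y). *)
Let v : R := ((fine (covariance mu X X))%:M - reg_coef *m c^T) 0 0.

Let reg_coef_cov : b' *m SXY = row_mx v%:M 0.
Proof.
rewrite cov_mx_joint mul_row_block !mul1mx !mulNmx /reg_coef mulmxKV ?subrr//.
  by congr row_mx; rewrite [LHS]mx11_scalar.
exact: cov_mx_sub_unit.
Qed.

Lemma int_residual_Y k : \int[mu]_x (residual x * Y k x) = 0.
Proof.
have r2 := residual_L2.
have : \int[mu]_x (residual x * (Y k x - mean (Y k))) = 0.
  have : (b' *m SXY) 0 (rshift 1 k) = _ :=
    lincomb_cov joint_vec_L2 b' (rshift 1 k).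
  by rewrite reg_coef_cov row_mxEr mxE joint_vec_rshift residualE.
under eq_Rintegral do rewrite mulrBr.
rewrite intB; [|exact: L2_mul|by apply: L2_mul => //; exact: L2_cst].
under [X in _ - X = _]eq_Rintegral do rewrite mulrC.
by rewrite intZ ?int_residual ?mulr0 ?subr0//; exact: L2_L1.
Qed.

Let residual_var : \int[mu]_x residual x ^+ 2 = v.
Proof.
rewrite residualE -lincomb_var; last exact: joint_vec_L2.
rewrite reg_coef_cov tr_row_mx mul_row_col mul0mx addr0.
by rewrite trmx1 mulmx1 mxE eqxx mulr1n.
Qed.

(** Adding to the first row of Sigma(X, Y) the combination of the others with
coefficients [- reg_coef] annihilates the covariances of X with Y and leaves
the variance of the residual in the corner. *)
Lemma det_cov_mx_joint : \det SXY = (\int[mu]_x residual x ^+ 2) * \det SY.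
Proof.
pose E : 'M[R]_(1 + n) := block_mx 1%:M (- reg_coef) 0 1%:M.
have <- : \det (E *m SXY) = \det SXY.
  by rewrite det_mulmx det_ublock !det1 !mul1r.
have -> : E *m SXY = block_mx v%:M 0 c^T SY.
  have := reg_coef_cov; rewrite cov_mx_joint mul_row_block => /eq_row_mx[e1 e2].
  by rewrite mulmx_block e1 e2 !mul0mx !add0r !mul1mx.
by rewrite det_lblock det_scalar1 residual_var.
Qed.

Lemma residual_var_gt0 : 0 < \int[mu]_x residual x ^+ 2.
Proof.
rewrite lt0r Rintegral_ge0 ?andbT; last by move=> x _; exact: sqr_ge0.
apply/eqP => v0; move: SXY_unit.
by rewrite unitmxE det_cov_mx_joint v0 mul0r unitr0.
Qed.

End regression.

End covariance_forms.

(** * The optimisation problem *)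

Section optimisation.
Context {disp : measure_display} {T : measurableType disp} {R : realType}.
Variables (mu P : probability T R) (n : nat) (X : T -> R) (Y : 'I_n -> T -> R).

Local Notation L1 := (Lfun mu 1).
Local Notation L2 := (Lfun mu 2%:E).
Local Notation l := (RNderiv mu P).
Local Notation r := (residual mu X Y).

Hypotheses (X2 : X \in L2) (Y2 : forall i, Y i \in L2).
Hypotheses (Pmu : P `<< mu) (l2 : l \in L2).
Hypothesis SXY_unit : cov_mx mu (joint_vec X Y) \in unitmx.
Variable delta : R.
Hypothesis delta_gt0 : 0 < delta.

(* Fixes mu, which a term 'E_Q[f] does not determine. *)
Let expectationQ := @RNderiv_expectation _ _ _ mu.

(** Translates feasibility into conditions on the density of [Q].  A finite
divergence makes the density square-integrable, because [l] is. *)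
Lemma feasibleP Q : feasible mu P Y delta Q <->
  [/\ Q `<< mu, RNderiv mu Q \in L2,
      \int[mu]_x (RNderiv mu Q x - l x) ^+ 2 <= delta &
      forall i, \int[mu]_x (RNderiv mu Q x * Y i x) = \int[mu]_x (l x * Y i x)].
Proof.
split.
- move=> -[]; rewrite /Dmu; case: asboolP => [Qmu|_]; last first.
    by rewrite leye_eq.
  move=> D EY; set q := RNderiv mu Q in D *.
  have mq : measurable_fun setT q by exact: RNderiv_measurable.
  have h2 : (fun x => q x - l x) \in L2.
    apply: sqr_lty_L2; first by apply: measurable_funB => //; exact: L2_measurable l2.
    by apply: le_lt_trans D _; exact: ltry.
  have q2 : q \in L2.
    by have := L2_add h2 l2; under eq_fun do rewrite subrK.
  split=> // [|i].
    by rewrite -lee_fin -expectation_fin//; exact: L2_sqr h2.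
  by have := EY i; rewrite !expectationQ// => -[].
- move=> [Qmu q2 D EY]; split; last first.
    by move=> i; rewrite !expectationQ// EY.
  rewrite /Dmu; case: asboolP => // _.
  by rewrite expectation_fin ?lee_fin//; apply/L2_sqr/L2_sub.
Qed.

(** X and its residual differ by an affine function of Y, to which [h] is
orthogonal. *)
Lemma int_mul_residual h : h \in L2 -> \int[mu]_x h x = 0 ->
  (forall i, \int[mu]_x (h x * Y i x) = 0) ->
  \int[mu]_x (h x * X x) = \int[mu]_x (h x * r x).
Proof.
move=> h2 h0 hY.
have hcst (a : R) : \int[mu]_x (h x * a) = 0.
  by under eq_Rintegral do rewrite mulrC; rewrite intZ ?h0 ?mulr0//; exact: L2_L1.
have ha1 (a : R) : (fun x => h x * a) \in L1.
  by apply: L2_mul => //; exact: L2_cst.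
have hc g : g \in L2 ->
    \int[mu]_x (h x * (g x - fine 'E_mu[g]%E)) = \int[mu]_x (h x * g x).
  move=> g2; under eq_Rintegral do rewrite mulrBr.
  by rewrite intB ?hcst ?subr0//; exact: L2_mul.
rewrite /residual; under [RHS]eq_Rintegral do rewrite mulrBr.
rewrite intB; last 2 first.
- by apply: L2_mul => //; exact: centered_L2.
- by apply: L2_mul => //; exact: lincomb_L2.
rewrite hc// int_mul_lincomb// big1 ?subr0// => j _.
by rewrite hc// hY mulr0.
Qed.

(* [lopt] is the minimiser of the problem without the sign constraint on the
   density; [c] is chosen so that [lopt] is at divergence [delta] from [l]. *)
Let v := \int[mu]_x r x ^+ 2.
Let c := Num.sqrt (delta / v).
Let lopt x := l x - c * r x.
Let r2 : r \in L2. Proof. exact: residual_L2. Qed.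
Let v_gt0 : 0 < v. Proof. exact: residual_var_gt0. Qed.
Let c_gt0 : 0 < c. Proof. by rewrite sqrtr_gt0 divr_gt0. Qed.
Let c2v : c ^+ 2 * v = delta.
Proof. by rewrite sqr_sqrtr ?divfK ?gt_eqF// divr_ge0 ?ltW. Qed.
Let cv : c * v = Num.sqrt (delta * v).
Proof.
have c2v2 : (c * v) ^+ 2 = delta * v by rewrite exprMn expr2 expr2 -c2v; ring.
by rewrite -c2v2 sqrtr_sqr ger0_norm// mulr_ge0 ?ltW.
Qed.
Let lopt2 : lopt \in L2.
Proof. by apply: L2_sub => //; exact: L2_scale. Qed.

(** With h the difference of the densities of [Q] and [P], the left-hand side is
E h^2 + 2 c E (h r) + c^2 v.  Here E h^2 <= delta, c^2 v = delta,
E (h r) is the difference of the expectations of X, and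
delta = c sqrt (delta v). *)
Lemma int_sqr_sub_lopt Q : feasible mu P Y delta Q ->
  \int[mu]_x (RNderiv mu Q x - lopt x) ^+ 2 <=
  2 * c * (\int[mu]_x (RNderiv mu Q x * X x) -
           (\int[mu]_x (l x * X x) - Num.sqrt (delta * v))).
Proof.
move=> /feasibleP[Qmu q2 D EY]; set q := RNderiv mu Q in q2 D EY *.
pose h x := q x - l x.
have h2 : h \in L2 by exact: L2_sub.
have h0 : \int[mu]_x h x = 0.
  by rewrite intB ?(L2_L1 q2) ?(L2_L1 l2)// !RNderiv_int1// subrr.
have hf f : f \in L2 ->
    \int[mu]_x (h x * f x) = \int[mu]_x (q x * f x) - \int[mu]_x (l x * f x).
  move=> f2; rewrite -intB; [|exact: L2_mul|exact: L2_mul].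
  by apply: eq_Rintegral => x _; rewrite mulrBl.
have hX : \int[mu]_x (h x * X x) = \int[mu]_x (h x * r x).
  by apply: int_mul_residual => // i; rewrite hf// EY subrr.
have -> : \int[mu]_x (q x - lopt x) ^+ 2 = \int[mu]_x (h x + c * r x) ^+ 2.
  by apply: eq_Rintegral => x _; rewrite /lopt /h; ring.
rewrite int_sqrD// -hX hf// -/v c2v -cv.
have -> : 2 * c * (\int[mu]_x (q x * X x) - (\int[mu]_x (l x * X x) - c * v)) =
  2 * c * (\int[mu]_x (q x * X x) - \int[mu]_x (l x * X x)) + 2 * (c ^+ 2 * v).
  by ring.
rewrite c2v; move: D; rewrite -/(h _); lra.
Qed.

Local Open Scope ereal_scope.

Let inf := ereal_inf [set 'E_Q[X] | Q in feasible mu P Y delta].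
Let bound := 'E_P[X] - (Num.sqrt (delta * v))%:E.

Let boundE : bound = (\int[mu]_x (l x * X x) - Num.sqrt (delta * v))%R%:E.
Proof. by rewrite /bound expectationQ. Qed.

Lemma bound_le_inf : bound <= inf.
Proof.
apply: le_ereal_inf_tmp => _ [Q FQ <-].
have [Qmu q2 _ _] := (feasibleP Q).1 FQ.
rewrite boundE expectationQ// lee_fin -subr_ge0.
rewrite -(pmulr_rge0 _ (mulr_gt0 (ltr0Sn R 1) c_gt0)).
apply: le_trans (int_sqr_sub_lopt FQ).
by apply: Rintegral_ge0 => x _; exact: sqr_ge0.
Qed.

(** The density of a feasible measure is nonnegative, so its distance to [lopt]
is pointwise at least the negative part of [lopt]; by [int_sqr_sub_lopt] the
integral of the square of that negative part is below every positive
number. *)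
Lemma lopt_ge0_of_inf : inf = bound -> {ae mu, forall x, (0 <= lopt x)%R}.
Proof.
move=> infE; pose N x := Num.min (lopt x) 0%R.
have mN : measurable_fun setT N.
  by apply: measurable_minr => //; exact: L2_measurable lopt2.
have N2 : N \in L2.
  apply: L2_dominated lopt2 _ => //; apply: aeW => x.
  by rewrite /N minEle; case: ifP => // _; rewrite expr0n sqr_ge0.
suff N0 : (\int[mu]_x N x ^+ 2 = 0)%R.
  have := int_sqr_eq0 N2 N0; apply: filterS => x.
  by rewrite /N minEle; case: ifP => [_ ->//|/negbT]; rewrite -ltNge => /ltW.
have Nge0 : (0 <= \int[mu]_x N x ^+ 2)%R.
  by apply: Rintegral_ge0 => x _; exact: sqr_ge0.
apply/eqP; rewrite eq_le Nge0 andbT leNgt; apply/negP => Ngt0.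
set e := (\int[mu]_x _)%R in Nge0 Ngt0.
have c20 : (0 < 2 * c)%R by rewrite mulr_gt0.
(* A feasible Q beating the bound by less than e / (2 c) would make the estimate
   of int_sqr_sub_lopt smaller than e. *)
have : inf < bound + (e / (2 * c))%:E.
  by rewrite infE boundE -EFinD lte_fin ltrDl divr_gt0.
move=> /ereal_inf_lt[_ [Q FQ <-]].
have [Qmu q2 _ _] := (feasibleP Q).1 FQ.
rewrite boundE expectationQ// -EFinD lte_fin -ltrBlDl => ltQ.
have := int_sqr_sub_lopt FQ; apply/negP; rewrite -ltNge.
apply: (@lt_le_trans _ _ e); first by rewrite mulrC -ltr_pdivlMr.
apply: le_int_ae => //.
- exact: L2_sqr.
- by apply/L2_sqr/L2_sub.
- by move=> x; exact: sqr_ge0.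
- by move=> x; exact: sqr_ge0.
- have := RNderiv_ge0 Qmu; apply: filterS => x q0.
  rewrite /N minEle; case: ifP => lx; last by rewrite expr0n sqr_ge0.
  by rewrite -sqrrN ler_sqr ?nnegrE ?oppr_ge0// ?lerDr// subr_ge0 (le_trans lx).
Qed.

(** [lopt] integrates to 1 since the residual is centred, it satisfies the
moment constraints since the residual is orthogonal to Y, and the divergence
constraint is saturated by the choice of [c]. *)
Lemma inf_of_lopt_ge0 : {ae mu, forall x, (0 <= lopt x)%R} -> inf = bound.
Proof.
move=> l0; apply/eqP; rewrite eq_le bound_le_inf andbT.
(* A version of lopt that is nonnegative everywhere, not only almost surely. *)
pose g x := Num.max (lopt x) 0%R.
have ml := L2_measurable lopt2.
have mg : measurable_fun setT g by exact: measurable_maxr.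
have gE : {ae mu, forall x, g x = lopt x}.
  by apply: filterS l0 => x l0; rewrite /g max_l.
have g0 x : (0 <= g x)%R by rewrite /g le_max lexx orbT.
have g2 : g \in L2.
  by apply: L2_dominated lopt2 _ => //; apply: filterS gE => x ->.
have [|Q [Qmu Qg]] := @probability_of_density _ _ _ mu g mg g0.
  have int_g : (\int[mu]_x g x = 1)%R.
    rewrite (int_ae mg ml gE) intB ?RNderiv_int1//; [|exact: L2_L1|]; last first.
      exact/L2_L1/L2_scale.
    by rewrite intZ ?int_residual ?mulr0 ?subr0//; exact: L2_L1.
  by rewrite -int_g -expectation_fin ?L2_L1// unlock.
set q := RNderiv mu Q in Qg.
have qE : {ae mu, forall x, q x = lopt x} by apply: filterS2 Qg gE => x ->.
have mq : measurable_fun setT q by exact: RNderiv_measurable.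
have q2 : q \in L2.
  by apply: L2_dominated lopt2 _ => //; apply: filterS qE => x ->.
have int_rX : (\int[mu]_x (r x * X x) = v)%R.
  rewrite int_mul_residual//.
  - exact: int_residual.
  - by move=> i; exact: int_residual_Y.
have qf f : f \in L2 -> (\int[mu]_x (q x * f x) =
    \int[mu]_x (l x * f x) - c * \int[mu]_x (r x * f x))%R.
  move=> f2; have mf := L2_measurable f2.
  rewrite -intZ; last exact: L2_mul.
  rewrite -intB; [|exact: L2_mul|]; last first.
    by under eq_fun do rewrite mulrA; apply: L2_mul => //; exact: L2_scale.
  apply: int_ae; [exact: measurable_funM| |].
    apply: measurable_funB; first by apply: measurable_funM => //; exact: L2_measurable l2.
    by apply: measurable_funM => //; apply: measurable_funM => //; exact: L2_measurable r2.
  by apply: filterS qE => x ->; rewrite /lopt; ring.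
have FQ : feasible mu P Y delta Q.
  apply/feasibleP; split => // [|i]; last first.
    by rewrite qf// int_residual_Y// mulr0 subr0.
  rewrite -c2v /v -intZ; last exact: L2_sqr.
  rewrite le_eqVlt; apply/orP; left; apply/eqP; apply: int_ae.
  - apply: measurable_funX; apply: measurable_funB => //; exact: L2_measurable l2.
  - apply: measurable_funM => //; apply: measurable_funX; exact: L2_measurable r2.
  - by apply: filterS qE => x; rewrite -/q => ->; rewrite /lopt; ring.
have -> : bound = 'E_Q[X].
  by rewrite boundE expectationQ// qf// int_rX cv.
by apply: ereal_inf_lbound; exists Q.
Qed.

End optimisation.

(** * Lower bound and equality case *)

Section densities_in_the_hypotheses.
Context {disp : measure_display} {T : measurableType disp} {R : realType}.
Variable mu : probability T R.

(** Measurability of [L] is what makes its second moment comparable with that of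
[RNderiv mu P], to which it is only almost surely equal. *)
Lemma sigma_measurable_measurable n (Z : 'I_n -> T -> R) (L : T -> R) :
  (forall i, measurable_fun setT (Z i)) -> sigma_measurable Z L ->
  measurable_fun setT L.
Proof.
move=> mZ mL _ B mB; rewrite setTI; have := mL B mB.
apply: smallest_sub; first exact: sigma_algebra_measurable.
elim/big_ind: _ => [A //|A B' sA sB|i _ A [C mC <-]].
  by rewrite subUset.
exact: mZ.
Qed.

Lemma is_RNderiv_L2 (P : probability T R) (L : T -> R) :
  is_RNderiv mu P L -> measurable_fun setT L ->
  ('E_mu[fun w => (L w ^+ 2)%R] < +oo)%E -> RNderiv mu P \in Lfun mu 2%:E.
Proof.
move=> [Pmu LE] mL L2; apply: (L2_dominated _ (sqr_lty_L2 mL L2)).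
  exact: RNderiv_measurable.
by apply: filterS LE => x /= /(_ I) ->.
Qed.

End densities_in_the_hypotheses.

Theorem corollary1
    (disp : measure_display) (T : measurableType disp) (R : realType)
    (d : nat) (hd : (2 <= d)%N)
    (X : {mfun T >-> R}) (Y : 'I_d.-1 -> {mfun T >-> R})
    (mu P : probability T R) (L : T -> R)
    (HL : is_RNderiv mu P L)
    (HLmeas : sigma_measurable (joint_vec X (fun i => Y i)) L)
    (HX2 : ('E_mu[fun w => (X w ^+ 2)%R] < +oo)%E)
    (HY2 : forall i : 'I_d.-1, ('E_mu[fun w => (Y i w ^+ 2)%R] < +oo)%E)
    (HL2 : ('E_mu[fun w => (L w ^+ 2)%R] < +oo)%E)
    (HSigma : cov_mx mu (joint_vec X (fun i => Y i)) \in unitmx)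
    (delta : R) (hdelta : 0 < delta) :
  let Yv : 'I_d.-1 -> T -> R := fun i => Y i in
  let detXY : R := \det (cov_mx mu (joint_vec X Yv)) in
  let detY : R := \det (cov_mx mu Yv) in
  let infimum : \bar R :=
    ereal_inf [set 'E_P'[X]%E | P' in feasible mu P Yv delta] in
  let bound : \bar R :=
    ('E_P[X] - (Num.sqrt (delta * (detXY / detY)))%:E)%E in
  (bound <= infimum)%E /\
  (infimum = bound <->
   {ae mu, forall w : T,
      X w - fine 'E_mu[X]%E
      - (cov_row mu X Yv *m invmx (cov_mx mu Yv) *m centered_col mu Yv w) 0 0
      - Num.sqrt (detXY / (delta * detY)) * L w <= 0}).
Proof.
move=> Yv detXY detY infimum bound.
have X2 : (X : T -> R) \in Lfun mu 2%:E.
  by apply: sqr_lty_L2 HX2; exact: measurable_funPT.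
have Y2 i : Yv i \in Lfun mu 2%:E.
  by apply: sqr_lty_L2 (HY2 i); exact: measurable_funPT.
have mL : measurable_fun setT L.
  apply: sigma_measurable_measurable HLmeas => i.
  by rewrite /joint_vec; case: unliftP.
have l2 := is_RNderiv_L2 HL mL HL2.
have [Pmu LE] := HL.
pose r := residual mu X Yv; pose v := \int[mu]_x r x ^+ 2.
have v_gt0 : 0 < v by exact: residual_var_gt0.
have detY_neq0 : detY != 0.
  by rewrite -unitfE -unitmxE; exact: (cov_mx_sub_unit X2 Y2 HSigma).
have detE : detXY / detY = v.
  by rewrite [detXY]det_cov_mx_joint// mulfK.
have dv : detXY / (delta * detY) = v / delta.
  by rewrite -detE invfM mulrA mulrAC.
rewrite /bound detE dv; split; first exact: bound_le_inf.
set s := Num.sqrt (v / delta).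
have s_gt0 : 0 < s by rewrite sqrtr_gt0 divr_gt0.
have cE : Num.sqrt (delta / v) = s^-1 by rewrite -sqrtrV ?invf_div// divr_ge0 ?ltW.
have signE w y : (r w - s * y <= 0) = (0 <= y - Num.sqrt (delta / v) * r w).
  by rewrite cE subr_le0 subr_ge0 [_^-1 * _]mulrC ler_pdivrMr// [y * s]mulrC.
split=> [/(lopt_ge0_of_inf X2 Y2 Pmu l2 HSigma hdelta) H|H].
- apply: filterS2 H LE => w /= H /(_ I) ->.
  by rewrite signE.
- apply: (inf_of_lopt_ge0 X2 Y2 Pmu l2 HSigma hdelta).
  apply: filterS2 H LE => w /= + /(_ I) <-.
  by rewrite signE.
Qed.
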